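(* Let $M=(E,\rho)$ be a matroid of rank $d\ge 1$ with $\#E=m$ and with no loops. Then for all $0\le i\le d-1$ and $1\le j\le m-d+1+i$, $$[p^{d-1-i+j}t^i]\,\widehat{Y}_M(p,t)=\omega_j^{i,M}=\operatorname{rank} WH_{j-1}(\mathcal{L}_i^M;\mathbb{Z}).$$
   Context: A matroid $M=(E,\rho)$ has finite ground set $E$ and rank function $\rho:2^E\to\mathbb{N}$; its rank is $d(M)=\rho(E)$, and the corank function is $\sigma(S)=\#S-\rho(S)$. The Tutte polynomial is $T_M(x,y)=\sum_{S\subseteq E}(x-1)^{\rho(E)-\rho(S)}(y-1)^{\sigma(S)}$. Define $Y_M(q,t):=(1-q)^{\rho(E)}q^{\sigma(E)}T_M\!\left(\frac{qt+1-q}{1-q},\frac1q\right)$ (a polynomial) and $$\widehat{Y}_M(p,t):=\frac{(-1)^{d(M)}Y_M(1+p,-t)-t^{d(M)}}{1+t}.$$ $[p^at^b]F$ denotes the coefficient of $p^at^b$ in $F$. For $0\le i\le d-1$, let $\mathcal{S}_i^M$ be the set of all $S\subseteq E$ with $\rho(S)\ge d-i$, partially ordered by inclusion, and let $\mathcal{L}_i^M:=\{\hat 0\}\oplus\mathcal{S}_i^M$ be obtained by adjoining a new minimum $\hat 0$. Let $\mu_i^M(S)$ denote the Möbius function value $\mu(\hat 0,S)$ in $\mathcal{L}_i^M$ (and $\mu_i^M(S):=0$ if $S\notin\mathcal{S}_i^M$). For $0\le i\le d-1$ and $1\le j\le m-d+1+i$ put $\omega_j^{i,M}:=(-1)^j\sum_{S\in\mathcal{S}_i^M:\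 \#S-d+1+i=j}\mu_i^M(S)$. For a poset $P$ with minimum $\hat 0$, its Whitney homology is $WH_k(P;\mathbb{Z})=\bigoplus_{\hat 0<\sigma\in P}\widetilde{H}_{k-1}(\Delta([\hat 0,\sigma]);\mathbb{Z})$, where $\Delta([\hat 0,\sigma])$ is the order complex of the interval (the simplicial complex of chains of the open interval $(\hat 0,\sigma)$) and $\widetilde H$ denotes reduced simplicial homology. *)

(* Defs.v *)
From HB Require Import structures.
From mathcomp Require Import all_boot all_order all_algebra.
From mathcomp Require Import ring_quotient boolp.

Set Implicit Arguments.
Unset Strict Implicit.
Unset Printing Implicit Defensive.

Import Order.TTheory GRing.Theory Num.Theory.
Local Open Scope ring_scope.

Record matroid (E : finType) := Matroid {
  rk :> {set E} -> nat;
  rk_card : forall A, (rk A <= #|A|)%N;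
  rk_mono : forall A B : {set E}, A \subset B -> (rk A <= rk B)%N;
  rk_submod : forall A B, (rk (A :|: B) + rk (A :&: B) <= rk A + rk B)%N }.

Section TuttePolynomial.
Variables (E : finType) (M : matroid E).

Definition mrank : nat := M [set: E].

Definition corank (A : {set E}) : nat := (#|A| - M A)%N.

Definition loop (e : E) : bool := M [set e] == 0%N.

(* As in polyXY: ['X] is x and ['Y := 'X%:P] is y. The subtractions on [nat]
   are exact by [rk_mono] and [rk_card]. *)
Definition Tutte : {poly {poly int}} :=
  \sum_(A : {set E}) ('X - 1) ^+ (mrank - M A) * ('Y - 1) ^+ corank A.

Definition Tutte_at (K : fieldType) (x y : K) : K :=
  (map_poly (map_poly intr) Tutte).[x, y].

Lemma Tutte_atE (K : fieldType) (x y : K) :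
  Tutte_at x y =
  \sum_(A : {set E}) (x - 1) ^+ (mrank - M A) * (y - 1) ^+ corank A.
Proof.
rewrite /Tutte_at rmorph_sum !horner_sum; apply: eq_bigr => A _.
rewrite rmorphM !rmorphXn !rmorphB !rmorph1 /= map_polyX map_polyC /= map_polyX.
by rewrite !hornerE.
Qed.

Definition Y (K : fieldType) (q t : K) : K :=
  (1 - q) ^+ mrank * q ^+ corank [set: E]
  * Tutte_at ((q * t + 1 - q) / (1 - q)) q^-1.

(* Z[p][t], with t the outer variable, and its fraction field Q(p, t). *)
Definition polypt := {poly {poly int}}.
Definition ratpt := {fraction polypt}.
Definition pvar : ratpt := tofrac ('X%:P : polypt).
Definition tvar : ratpt := tofrac ('X : polypt).

(* Y and Yhat are polynomials only after simplification of the quotients, so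
   Yhat is introduced as a rational function. Since 1 + p is transcendental,
   [Y (1 + pvar) (- tvar)] is the substitution q := 1 + p, t := - t in the
   rational function Y_M(q, t). *)
Definition Yhat : ratpt :=
  ((-1) ^+ mrank * Y (1 + pvar) (- tvar) - tvar ^+ mrank) / (1 + tvar).

End TuttePolynomial.

Definition coefpt (a b : nat) (F : polypt) : int := F`_b`_a.

Section Moebius.
Context {disp : Order.disp_t} {P : finPOrderType disp}.
Implicit Types x y z : P.

(* The fuel [#|P|] suffices: every recursive call goes strictly down.
   See [moebiusxx], [moebius_lt] and [moebius_out]. *)
Fixpoint moebius_fuel (n : nat) (x y : P) : int :=
  if n is n'.+1 then
    if x == y then 1
    else if (x < y)%O then - \sum_(z : P | (x <= z < y)%O) moebius_fuel n' x z
    else 0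
  else 0.

Definition moebius (x y : P) : int := moebius_fuel #|P| x y.

Let height y := #|[set z : P | (z <= y)%O]|.

Let height_gt0 y : (0 < height y)%N.
Proof. by apply/card_gt0P; exists y; rewrite inE. Qed.

Let height_lt z y : (z < y)%O -> (height z < height y)%N.
Proof.
move=> zy; apply/proper_card/properP; split.
  by apply/subsetP => w; rewrite !inE => wz; apply: le_trans wz (ltW zy).
by exists y; rewrite inE ?lexx ?lt_geF.
Qed.

Let moebius_fuel_stable n m x y :
  (height y <= n)%N -> (height y <= m)%N ->
  moebius_fuel n x y = moebius_fuel m x y.
Proof.
elim: n m y => [|n IHn] [|m] y; rewrite ?leqn0.
- by [].
- by move=> /eqP h0; have := height_gt0 y; rewrite h0.
- by move=> _ /eqP h0; have := height_gt0 y; rewrite h0.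
move=> hn hm /=; case: eqP => // _; case: ifP => // _.
congr (- _); apply: eq_bigr => z /andP[_ /height_lt zy].
by apply: IHn; rewrite -ltnS; [exact: leq_trans zy hn | exact: leq_trans zy hm].
Qed.

Let moebiusE x y : moebius x y =
  if x == y then 1
  else if (x < y)%O then - \sum_(z : P | (x <= z < y)%O) moebius x z
  else 0.
Proof.
have hP z : (height z <= #|P|)%N by exact: max_card.
rewrite {1}/moebius (@moebius_fuel_stable _ #|P|.+1) ?(leqW (hP _)) //=.
Qed.

Lemma moebiusxx x : moebius x x = 1.
Proof. by rewrite moebiusE eqxx. Qed.

Lemma moebius_lt x y : (x < y)%O ->
  moebius x y = - \sum_(z : P | (x <= z < y)%O) moebius x z.
Proof. by move=> xy; rewrite moebiusE xy lt_eqF. Qed.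

Lemma moebius_out x y : ~~ (x <= y)%O -> moebius x y = 0.
Proof.
by rewrite le_eqVlt negb_or moebiusE => /andP[/negbTE-> /negbTE->].
Qed.

End Moebius.

Record simplicial_complex (V : finType) := SimplicialComplex {
  faces :> {set {set V}};
  faces_closed : forall A B : {set V}, A \subset B -> B \in faces -> A \in faces }.

Section Homology.
Variables (V : finType) (K : simplicial_complex V).
Implicit Types k : int.

(* The empty face, when present, has dimension -1. *)
Definition face k := {A : {set V} | (A \in faces K) && (#|A|%:Z == k + 1)}.

Definition chain k := {ffun face k -> int}.
HB.instance Definition _ k := GRing.Zmodule.on (chain k).

(* Faces are oriented by the enumeration of V: [incidence A B] is the
   coefficient of B in the boundary of A. *)
Definition incidence (A B : {set V}) : int :=
  \sum_(v in A | A :\ v == B)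
    (-1) ^+ #|[set w in A | (enum_rank w < enum_rank v)%N]|.

(* Used for l = k - 1 only; keeping l free avoids casts along (k + 1) - 1 = k. *)
Definition boundary k l (c : chain k) : chain l :=
  [ffun B : face l => \sum_(A : face k) incidence (val A) (val B) * c A].

Lemma boundary_is_zmod_morphism k l : zmod_morphism (@boundary k l).
Proof.
move=> c c'; apply/ffunP => B; rewrite !ffunE -sumrB.
by apply: eq_bigr => A _; rewrite !ffunE mulrBr.
Qed.
HB.instance Definition _ k l :=
  GRing.isZmodMorphism.Build (chain k) (chain l) (@boundary k l)
    (@boundary_is_zmod_morphism k l).

Definition is_cycle k : {pred chain k} :=
  fun c => boundary (k - 1) c == 0.

Fact is_cycle_zmod_closed k : zmod_closed (@is_cycle k).
Proof.
split=> [|c c']; rewrite !unfold_in /is_cycle ?raddf0 //.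
by move=> /eqP c0 /eqP c'0; rewrite raddfB /= c0 c'0 subr0.
Qed.
HB.instance Definition _ k :=
  GRing.isZmodClosed.Build (chain k) (@is_cycle k) (@is_cycle_zmod_closed k).

Record cycle k := Cycle {
  chain_of_cycle :> chain k;
  cycleP : chain_of_cycle \in @is_cycle k }.
HB.instance Definition _ k := [isSub for @chain_of_cycle k].
HB.instance Definition _ k := [Choice of cycle k by <:].
HB.instance Definition _ k := [SubChoice_isSubZmodule of cycle k by <:].

Definition is_boundary k : {pred cycle k} :=
  fun z => `[< exists c : chain (k + 1), boundary k c = val z >].

Fact is_boundary_zmod_closed k : zmod_closed (@is_boundary k).
Proof.
split=> [|z z']; rewrite !unfold_in /is_boundary.
  by apply/asboolP; exists 0; rewrite !raddf0.
move=> /asboolP[c cz] /asboolP[c' cz']; apply/asboolP.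
by exists (c - c'); rewrite !raddfB /= cz cz'.
Qed.
HB.instance Definition _ k :=
  GRing.isZmodClosed.Build (cycle k) (@is_boundary k)
    (@is_boundary_zmod_closed k).

Definition reduced_homology k : zmodType := Quotient.quot (@is_boundary k).

End Homology.

Section DirectSum.
Variables (I : finType) (V : I -> zmodType).

Definition direct_sum := {dffun forall i, V i}.
HB.instance Definition _ := Choice.on direct_sum.

Implicit Types u v w : direct_sum.

Definition dsum_zero : direct_sum := [ffun i => 0 : V i].
Definition dsum_opp u : direct_sum := [ffun i => - u i : V i].
Definition dsum_add u v : direct_sum := [ffun i => u i + v i : V i].

Fact dsum_addA : associative dsum_add.
Proof. by move=> u v w; apply/ffunP => i; rewrite !ffunE addrA. Qed.
Fact dsum_addC : commutative dsum_add.
Proof. by move=> u v; apply/ffunP => i; rewrite !ffunE addrC. Qed.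
Fact dsum_add0 : left_id dsum_zero dsum_add.
Proof. by move=> u; apply/ffunP => i; rewrite !ffunE add0r. Qed.
Fact dsum_addN : left_inverse dsum_zero dsum_opp dsum_add.
Proof. by move=> u; apply/ffunP => i; rewrite !ffunE addNr. Qed.

HB.instance Definition _ :=
  GRing.isZmodule.Build direct_sum dsum_addA dsum_addC dsum_add0 dsum_addN.

End DirectSum.

Definition Z_independent (V : zmodType) (n : nat) (v : 'I_n -> V) : Prop :=
  forall a : 'I_n -> int, \sum_(i < n) v i *~ a i = 0 -> forall i, a i = 0.

(* [has_rank V r]: the maximal size of a Z-independent family of V is r. *)
Definition has_rank (V : zmodType) (r : nat) : Prop :=
  (exists v : 'I_r -> V, Z_independent v) /\
  (forall (n : nat) (v : 'I_n -> V), Z_independent v -> (n <= r)%N).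

Section OrderComplex.
Context {disp : Order.disp_t} {P : finPOrderType disp}.

Definition order_complex_faces (x y : P) : {set {set P}} :=
  [set C : {set P} |
    [forall a in C, (x < a < y)%O] &&
    [forall a in C, forall b in C, (a >=< b)%O]].

Fact order_complex_closed (x y : P) (A B : {set P}) : A \subset B ->
  B \in order_complex_faces x y -> A \in order_complex_faces x y.
Proof.
move=> /subsetP AB; rewrite !inE => /andP[/forall_inP Bxy /forall_inP Bch].
apply/andP; split; apply/forall_inP => a /AB aB; first exact: Bxy.
by apply/forall_inP => b /AB; apply/forall_inP/Bch.
Qed.

(* The order complex of [x, y]: the chains of the open interval (x, y). *)
Definition order_complex (x y : P) : simplicial_complex P :=
  SimplicialComplex (@order_complex_closed x y).

End OrderComplex.

Definition Whitney_homology {disp : Order.disp_t} (P : finBPOrderType disp)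
    (k : int) : zmodType :=
  direct_sum (fun s : {x : P | (\bot < x)%O} =>
    reduced_homology (order_complex \bot%O (val s)) (k - 1)).

Definition with_bot (T : Type) := option T.

Section WithBot.
Context {disp : Order.disp_t} {P : finPOrderType disp}.

HB.instance Definition _ := Finite.on (with_bot P).

Definition with_bot_le (x y : with_bot P) : bool :=
  match x, y with
  | None, _ => true
  | Some _, None => false
  | Some a, Some b => (a <= b)%O
  end.

Fact with_bot_le_refl : reflexive with_bot_le.
Proof. by case=> /=. Qed.
Fact with_bot_le_anti : antisymmetric with_bot_le.
Proof. by move=> [a|] [b|] //= /le_anti ->. Qed.
Fact with_bot_le_trans : transitive with_bot_le.
Proof. by move=> [a|] [b|] [c|] //=; exact: le_trans. Qed.

HB.instance Definition _ := Order.Le_isPOrder.Build disp (with_bot P)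
  with_bot_le_refl with_bot_le_anti with_bot_le_trans.

Fact with_bot_le0x (x : with_bot P) : ((None : with_bot P) <= x)%O.
Proof. by []. Qed.

HB.instance Definition _ :=
  Order.hasBottom.Build disp (with_bot P) with_bot_le0x.

End WithBot.

Section MatroidPosets.
Variables (E : finType) (M : matroid E) (i : nat).

Definition in_S (A : {set E}) : bool := (mrank M - i <= M A)%N.

Record S_poset := SPoset { set_of_S :> {set E}; S_posetP : in_S set_of_S }.
HB.instance Definition _ := [isSub for set_of_S].
HB.instance Definition _ := [Finite of S_poset by <:].

Definition S_le (A B : S_poset) : bool := val A \subset val B.

Fact S_le_refl : reflexive S_le.
Proof. by move=> A; exact: subxx. Qed.
Fact S_le_anti : antisymmetric S_le.
Proof. by move=> A B AB; apply/val_inj/eqP; rewrite eqEsubset. Qed.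
Fact S_le_trans : transitive S_le.
Proof. by move=> B A C; exact: subset_trans. Qed.

HB.instance Definition _ := Order.Le_isPOrder.Build (Order.Disp tt tt)
  S_poset S_le_refl S_le_anti S_le_trans.

Definition L_poset := with_bot S_poset.
HB.instance Definition _ := Order.FinBPOrder.on L_poset.

Definition moebius_L (A : {set E}) : int :=
  if insub A is Some s then moebius (\bot : L_poset)%O (Some s : L_poset)
  else 0.

(* The condition #A - d + 1 + i = j is read in Z: #A may be smaller than d. *)
Definition omega (j : nat) : int :=
  (-1) ^+ j *
  \sum_(A : {set E} | in_S A &&
      (#|A|%:Z - (mrank M)%:Z + 1 + i%:Z == j%:Z)) moebius_L A.

End MatroidPosets.

(* Main.v *)
(* Expanding over subsets, Yhat = sum_(i < d) Yhat_i(p) t^i with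
     Yhat_i = (-1)^(i+d) sum_(S in S_i) (-p)^#S (1+p)^(m-#S),
   the division by 1 + t being a telescoping of geometric sums. With r = d - i,
   the coefficient of p^(r-1+j) is the sum over the T of size r-1+j of
     (-1)^r sum_(S <= T, rk S >= r) (-1)^#S,
   which is (-1)^j mu(0,T) by Moebius inversion on the Boolean lattice.

   For the homology, the posets [C,T) = {S : C <= S < T, rk S >= r} with
   rk C <= r <= rk T have free homology concentrated in the single degree
   #T - #C + rk C - r - 1, by induction on #(T \ C). Let e be in T \ C. If
   rk (T \ e) < r, then [C,T) = [C+e,T). If deleting e from members of [C,T]
   preserves rk >= r, then S |-> S \ e retracts [C,T) onto a cone. Otherwise,
   removing the vertex T \ e, whose link is [C,T\e), leaves a poset that
   S |-> S + e retracts onto [C+e,T); the long exact sequence of this vertex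
   removal adds up the two ranks, as do the corresponding signed sums. *)
Require Import Defs.
From HB Require Import structures.
From mathcomp Require Import all_boot all_order all_algebra.
From mathcomp Require Import generic_quotient ring_quotient boolp zify ring.
Set Implicit Arguments.
Unset Strict Implicit.
Unset Printing Implicit Defensive.
Import Order.TTheory GRing.Theory Num.Theory.
Local Open Scope ring_scope.
Local Open Scope quotient_scope.

Lemma ffun_mulzE (I : finType) (f : {ffun I -> int}) (n : int) j :
  (f *~ n) j = f j *~ n.
Proof. by case: n => n; rewrite ?NegzE ?mulrNz ?ffunE ?ffunMnE. Qed.

(** * Boundary and cone operators on integer functions of all subsets *)

Section ChainsOnSubsets.
Variable V : finType.
Local Notation gchain := {ffun {set V} -> int}.
Implicit Types (A B : {set V}) (x v w : V) (b c : gchain).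

Definition rank_in v A : nat := #|[set w in A | (enum_rank w < enum_rank v)%N]|.

Lemma rank_inU1 v w A : w \notin A ->
  rank_in v (w |: A) = ((enum_rank w < enum_rank v) + rank_in v A)%N.
Proof.
move=> wA; rewrite /rank_in -!sum1dep_card.
by rewrite big_mkcondr big_setU1 //= -big_mkcondr; case: (_ < _)%N.
Qed.

Lemma rank_inU1_id v A : rank_in v (v |: A) = rank_in v A.
Proof.
by apply: eq_card => w; rewrite !inE; case: eqP => [->|]; rewrite ?ltnn ?andbF.
Qed.

(** Exactly one of [v], [w] precedes the other in the enumeration, so the two orders of insertion
    give exponents of opposite parity. *)
Lemma signr_rank_inU1 v w A : v != w -> v \notin A -> w \notin A ->
  (-1) ^+ (rank_in v (w |: A) + rank_in w A) =
  - (-1) ^+ (rank_in w (v |: A) + rank_in v A) :> int.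
Proof.
move=> vw vA wA; rewrite !rank_inU1 //.
have: enum_rank v != enum_rank w by rewrite (inj_eq enum_rank_inj).
rewrite -(inj_eq val_inj) neq_ltn /= => /orP[] lt.
  rewrite lt ltnNge (ltnW lt) /= add0n add1n exprS mulN1r opprK addnC //.
by rewrite lt ltnNge (ltnW lt) /= add0n add1n addSn exprS mulN1r addnC.
Qed.

(** Chains of all degrees are functions on one type, so that neither a degree nor a membership proof
    enters the algebra; being supported on faces is a separate predicate. *)
Definition bd c : gchain := [ffun B : {set V} => \sum_A incidence A B * c A].

Fact bd_is_zmod_morphism : zmod_morphism bd.
Proof.
move=> c c'; apply/ffunP => B; rewrite !ffunE -sumrB.
by apply: eq_bigr => A _; rewrite !ffunE mulrBr.
Qed.
HB.instance Definition _ :=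
  GRing.isZmodMorphism.Build gchain gchain bd bd_is_zmod_morphism.

Lemma bdE c B :
  bd c B = \sum_(v | v \notin B) (-1) ^+ rank_in v B * c (v |: B).
Proof.
rewrite ffunE; under eq_bigr do rewrite mulr_suml.
rewrite (exchange_big_dep (fun v => v \notin B)) /=; last first.
  by move=> A v _ /andP[_ /eqP <-]; rewrite !inE eqxx.
apply: eq_bigr => v vB; rewrite (big_pred1 (v |: B)); last first.
  move=> A; apply/andP/eqP => [[vA /eqP <-]|->]; first by rewrite setD1K.
  by rewrite setU11 setU1K.
by rewrite -/(rank_in _ _) rank_inU1_id.
Qed.

(* A chain [c] is [rest x c + cone x (link_part x c)], where neither
   [rest x c] nor [link_part x c] involves [x]. *)
Definition rest x c : gchain := [ffun A : {set V} => if x \in A then 0 else c A].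
Definition link_part x c : gchain :=
  [ffun A : {set V} => if x \in A then 0 else (-1) ^+ rank_in x A * c (x |: A)].
Definition cone x c : gchain :=
  [ffun A : {set V} => if x \in A then (-1) ^+ rank_in x A * c (A :\ x) else 0].

Fact rest_is_zmod_morphism x : zmod_morphism (rest x).
Proof. by move=> c c'; apply/ffunP=> B; rewrite !ffunE; case: ifP; rewrite ?subr0. Qed.
HB.instance Definition _ x :=
  GRing.isZmodMorphism.Build gchain gchain (rest x) (rest_is_zmod_morphism x).

Fact link_part_is_zmod_morphism x : zmod_morphism (link_part x).
Proof.
by move=> c c'; apply/ffunP=> B; rewrite !ffunE; case: ifP; rewrite ?subr0 ?mulrBr.
Qed.
HB.instance Definition _ x := GRing.isZmodMorphism.Build gchain gchain
  (link_part x) (link_part_is_zmod_morphism x).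

Fact cone_is_zmod_morphism x : zmod_morphism (cone x).
Proof.
by move=> c c'; apply/ffunP=> B; rewrite !ffunE; case: ifP; rewrite ?subr0 ?mulrBr.
Qed.
HB.instance Definition _ x :=
  GRing.isZmodMorphism.Build gchain gchain (cone x) (cone_is_zmod_morphism x).

Lemma rest_link_partK x c : rest x c + cone x (link_part x c) = c.
Proof.
apply/ffunP => A; rewrite !ffunE; case: ifP => xA; last by rewrite addr0.
have rA : rank_in x (A :\ x) = rank_in x A by rewrite -[in RHS](setD1K xA) rank_inU1_id.
by rewrite setD11 setD1K // add0r rA signrMK.
Qed.

Lemma rest_cone x b : rest x (cone x b) = 0.
Proof. by apply/ffunP => A; rewrite !ffunE; case: (x \in A). Qed.

Lemma link_part_cone x b : rest x b = b -> link_part x (cone x b) = b.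
Proof.
move=> xb; apply/ffunP => A; rewrite -[in RHS]xb !ffunE; case: ifP => // xA.
by rewrite setU11 setU1K ?xA // rank_inU1_id signrMK.
Qed.

Lemma rest_idem x c : rest x (rest x c) = rest x c.
Proof. by apply/ffunP => A; rewrite !ffunE; case: (x \in A). Qed.

Lemma link_part_rest x c : link_part x (rest x c) = 0.
Proof.
by apply/ffunP => A; rewrite !ffunE setU11 mulr0; case: ifP.
Qed.

(** Sets avoiding [x] arise in a boundary either from sets avoiding [x] or by deletion of [x]
    itself, which is what [link_part] records. *)
Lemma rest_bd x c : rest x (bd c) = bd (rest x c) + link_part x c.
Proof.
apply/ffunP => B; rewrite ffunE [in RHS]ffunE !bdE ffunE; case: ifP => xB.
  by rewrite addr0 big1 // => v _; rewrite ffunE inE xB orbT mulr0.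
rewrite (bigD1 x) ?xB //= [in RHS](bigD1 x) ?xB //= ffunE setU11 mulr0 add0r addrC.
congr (_ + _); apply: eq_bigr => v /andP[vB vx].
by rewrite ffunE !inE eq_sym (negPf vx) xB.
Qed.

(** Deleting [x] and deleting another vertex anticommute, by [signr_rank_inU1]. *)
Lemma link_part_bd x c : link_part x (bd c) = - bd (link_part x c).
Proof.
apply/ffunP => B; rewrite [LHS]ffunE [in RHS]ffunE !bdE; case: ifP => xB.
  by rewrite big1 ?oppr0 // => v _; rewrite ffunE inE xB orbT mulr0.
rewrite [in RHS](bigD1 x) ?xB //= ffunE setU11 mulr0 add0r mulr_sumr -sumrN.
apply: eq_big => [v|v]; rewrite !inE negb_or; first by rewrite andbC.
move=> /andP[vx vB]; rewrite ffunE !inE eq_sym (negPf vx) xB /=.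
rewrite !mulrA -!exprD setUCA -mulNr addnC signr_rank_inU1 ?xB //.
by congr (- (-1) ^+ _ * _); rewrite addnC.
Qed.

(** Read off from the two components of the boundary: its part off [x] is [b] and its link part is
    [- bd b]. *)
Lemma bd_cone x b : rest x b = b -> bd (cone x b) = b - cone x (bd b).
Proof.
move=> xb; rewrite -[LHS](rest_link_partK x) rest_bd link_part_bd.
by rewrite rest_cone link_part_cone // raddf0 add0r raddfN.
Qed.

End ChainsOnSubsets.

(** * Homology of clique complexes and removal of a vertex *)

Section CliqueHomology.
Variables (V : finType) (e : rel V).
Hypotheses (e_refl : reflexive e) (e_sym : symmetric e).
Local Notation gchain := {ffun {set V} -> int}.
Implicit Types (A Q R : {set V}) (x y v : V) (k : int) (b c z : gchain).

Definition clique A := [forall x in A, forall y in A, e x y].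

Lemma cliqueP A : reflect {in A &, forall x y, e x y} (clique A).
Proof.
apply: (iffP forall_inP) => h x; last by move=> xA; apply/forall_inP => y; exact: h.
by move=> y xA yA; have /forall_inP := h x xA; apply.
Qed.

(** The degree is an integer because the empty clique is a face of degree -1. *)
Definition cface Q k A := [&& A \subset Q, clique A & #|A|%:Z == k + 1].

Definition clique_chain Q k c := forall A, c A != 0 -> cface Q k A.

Definition clique_cycle Q k z := clique_chain Q k z /\ bd z = 0.

Definition clique_bdry Q k z := exists2 c, clique_chain Q (k + 1) c & bd c = z.

(** The homology of degree [k] is free of rank [r], stated through cycles whose classes form a basis
    rather than through a quotient group. *)
Definition free_homology Q k (r : nat) := exists2 h : 'I_r -> gchain,
  forall i, clique_cycle Q k (h i) &
  (forall z, clique_cycle Q k z ->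
     exists a : 'I_r -> int, clique_bdry Q k (z - \sum_i h i *~ a i)) /\
  (forall a : 'I_r -> int, clique_bdry Q k (\sum_i h i *~ a i) ->
     forall i, a i = 0).

(** In a clique complex the link of [x] is again a clique complex, on the neighbours of [x]; its
    vertex set is enough. *)
Definition link x Q := [set y in Q | (y != x) && e x y].

Lemma clique_chainP Q k c :
  clique_chain Q k c <-> forall A, ~~ cface Q k A -> c A = 0.
Proof.
split=> h A; first by apply: contraNeq => /h.
by apply: contraNT => /h ->.
Qed.

Lemma clique_chain0 Q k : clique_chain Q k 0.
Proof. by move=> A; rewrite ffunE eqxx. Qed.

Lemma clique_chainB Q k c c' :
  clique_chain Q k c -> clique_chain Q k c' -> clique_chain Q k (c - c').
Proof.
move=> /clique_chainP h /clique_chainP h'; apply/clique_chainP => A nA.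
by rewrite !ffunE h // h' // subr0.
Qed.

Lemma clique_chainN Q k c : clique_chain Q k c -> clique_chain Q k (- c).
Proof. by rewrite -[- c]add0r; apply/clique_chainB/clique_chain0. Qed.

Lemma clique_chainD Q k c c' :
  clique_chain Q k c -> clique_chain Q k c' -> clique_chain Q k (c + c').
Proof. by move=> h /clique_chainN h'; rewrite -[c']opprK; apply: clique_chainB. Qed.

Lemma clique_chain_comb Q k r (h : 'I_r -> gchain) (a : 'I_r -> int) :
  (forall i, clique_chain Q k (h i)) -> clique_chain Q k (\sum_i h i *~ a i).
Proof.
move=> hh; apply/clique_chainP => A nA; rewrite sum_ffunE big1 // => i _.
by rewrite ffun_mulzE (proj1 (clique_chainP _ _ _) (hh i)) // mul0rz.
Qed.

Lemma clique_chainS Q R k c : Q \subset R ->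
  clique_chain Q k c -> clique_chain R k c.
Proof.
by move=> QR h A /h /and3P[AQ cA dA]; rewrite /cface (subset_trans AQ QR) cA.
Qed.

Lemma clique_chain_rest Q k c x : clique_chain Q k c ->
  clique_chain (Q :\ x) k (rest x c).
Proof.
move=> h A; rewrite ffunE; case: ifP => xA; rewrite ?eqxx // => /h /and3P[AQ cA dA].
by rewrite /cface subsetD1 AQ xA cA.
Qed.

Lemma clique_chain_rest_id Q k c x : x \notin Q -> clique_chain Q k c ->
  rest x c = c.
Proof.
move=> xQ h; apply/ffunP => A; rewrite ffunE; case: ifP => // xA; apply/esym/eqP.
by apply: contraNT xQ => /h /and3P[/subsetP AQ _ _]; exact: AQ.
Qed.

Lemma clique_chain_link_part Q k c x : clique_chain Q k c ->
  clique_chain (link x Q) (k - 1) (link_part x c).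
Proof.
move=> h A; rewrite ffunE; case: ifP => xA; rewrite ?eqxx //.
rewrite mulf_eq0 signr_eq0 /= => /h /and3P[/subsetP AQ /cliqueP cA].
rewrite cardsU1 xA /= => /eqP dA; apply/and3P; split.
- apply/subsetP => y yA; rewrite inE AQ ?setU1r //= cA ?setU11 ?setU1r // andbT.
  by apply: contraTneq yA => ->; rewrite xA.
- by apply/cliqueP => y z yA zA; apply: cA; exact: setU1r.
- by apply/eqP; move: dA; rewrite PoszD; lia.
Qed.

Lemma clique_chain_cone Q k b x : x \in Q -> clique_chain (link x Q) k b ->
  clique_chain Q (k + 1) (cone x b).
Proof.
move=> xQ h A; rewrite ffunE; case: ifP => xA; rewrite ?eqxx //.
rewrite mulf_eq0 signr_eq0 /= => /h /and3P[/subsetP AQ /cliqueP cA dA].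
have AL y : y \in A -> y = x \/ (y \in link x Q).
  move=> yA; have [->|yx] := eqVneq y x; [by left | right].
  by apply: AQ; rewrite !inE yx.
apply/and3P; split.
- by apply/subsetP => y /AL[->//|]; rewrite inE => /andP[].
- apply/cliqueP => y z yA zA; have := AL y yA; have := AL z zA.
  rewrite !inE => -[->|/and3P[_ zx xz]] [->|/and3P[_ yx xy]] //; rewrite 1?e_sym //.
  by apply: cA; rewrite !inE ?yx ?zx.
- by move: dA; rewrite (cardsD1 x A) xA PoszD => /eqP ->; rewrite addrC.
Qed.

Lemma link_notin x Q : x \notin link x Q.
Proof. by rewrite !inE eqxx /= andbF. Qed.

Lemma link_sub x Q : link x Q \subset Q :\ x.
Proof. by apply/subsetP => y; rewrite !inE => /and3P[-> ->]. Qed.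

Lemma clique_bdry0 Q k : clique_bdry Q k 0.
Proof. by exists 0; [exact: clique_chain0 | rewrite raddf0]. Qed.

Lemma free_homology0P Q k : free_homology Q k 0 <->
  forall z, clique_cycle Q k z -> clique_bdry Q k z.
Proof.
split=> [[h _ [gen _]] z /gen[a]|acyc]; first by rewrite big_ord0 subr0.
exists (fun=> 0); first by case.
by split=> [z /acyc bz|a _ []//]; exists (fun=> 0); rewrite big_ord0 subr0.
Qed.

(** The only face is the empty set, of degree -1, and no nonzero multiple of it is a boundary. *)
Lemma free_homology_set0 k : free_homology set0 k (if k == -1 then 1%N else 0%N).
Proof.
have nobdry z : k = -1 -> clique_bdry set0 k z -> z = 0.
  move=> -> [c cc <-]; suff -> : c = 0 by rewrite raddf0.
  apply/ffunP => A; rewrite ffunE; apply/eqP; apply: contraT => /cc /and3P[].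
  by rewrite subset0 => /eqP -> _; rewrite cards0.
have chain0 z A : clique_chain set0 k z -> z A != 0 -> A = set0 /\ k = -1.
  move=> cz /cz /and3P[]; rewrite subset0 => /eqP -> _; rewrite cards0.
  by move=> /eqP k0; split=> //; lia.
case: eqP => k0; last first.
  apply/free_homology0P => z [cz _]; suff -> : z = 0 by exact: clique_bdry0.
  apply/ffunP => A; rewrite ffunE; apply/eqP; apply: contraT.
  by move=> /(chain0 _ _ cz)[_ /k0].
pose h : gchain := [ffun A : {set V} => (A == set0)%:R].
have ch : clique_chain set0 k h.
  move=> A; rewrite ffunE pnatr_eq0 eqb0 negbK => /eqP ->.
  rewrite /cface subxx cards0 k0 eqxx andbT.
  by apply/cliqueP => x y; rewrite inE.
have bd0 z : clique_chain set0 k z -> bd z = 0.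
  move=> cz; apply/ffunP => B; rewrite bdE ffunE big1 // => v _.
  have [->|/(chain0 _ _ cz)[/setP/(_ v)]] := eqVneq (z (v |: B)) 0; first exact: mulr0.
  by rewrite !inE eqxx.
exists (fun=> h); first by move=> i; split; [|exact: bd0].
split=> [z [cz _]|a]; last first.
  rewrite big_ord1 => /(nobdry _ k0)/ffunP/(_ set0).
  by rewrite ffun_mulzE !ffunE eqxx intz => a0 i; rewrite ord1.
exists (fun=> z set0); rewrite big_ord1; suff -> : z - h *~ z set0 = 0.
  exact: clique_bdry0.
apply/ffunP => A; rewrite !ffunE ffun_mulzE ffunE.
have [->|zA] := eqVneq A set0; first by rewrite intz subrr.
rewrite mul0rz subr0; apply/eqP; apply: contraNT zA => /(chain0 _ _ cz)[-> _].
exact: eqxx.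
Qed.

(** For a cycle [z], the cone with apex [x] over the part of [z] off [x] has boundary exactly
    [z]. *)
Lemma cone_free_homology Q k x : x \in Q -> {in Q, forall y, e x y} ->
  free_homology Q k 0.
Proof.
move=> xQ xe; apply/free_homology0P => z [zQ z0].
have QL : Q :\ x \subset link x Q.
  by apply/subsetP => y; rewrite !inE => /andP[-> yQ]; rewrite yQ xe.
exists (cone x (rest x z)).
  apply: clique_chain_cone => //; apply: clique_chainS QL _.
  exact: clique_chain_rest.
rewrite bd_cone ?rest_idem //; have := rest_bd x z; rewrite z0 raddf0.
by move=> /esym/eqP; rewrite addr_eq0 => /eqP ->; rewrite raddfN opprK rest_link_partK.
Qed.

(* Long exact sequence of the removal of [x]; only the pieces where the
   neighbouring terms vanish are needed. *)
Lemma free_homology_add_vertex Q k x r1 r2 : x \in Q ->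
  free_homology (Q :\ x) k r1 -> free_homology (link x Q) (k - 1) r2 ->
  ((0 < r1)%N -> free_homology (link x Q) k 0) ->
  ((0 < r2)%N -> free_homology (Q :\ x) (k - 1) 0) ->
  free_homology Q k (r1 + r2).
Proof.
move=> xQ [h1 h1c [gen1 ind1]] [h2 h2c [gen2 ind2]] acL acQ.
have xL := link_notin x Q.
have LQ := link_sub x Q; have QQ : Q :\ x \subset Q by rewrite subD1set.
have xQ' : x \notin Q :\ x by rewrite setD11.
(* As soon as [r2] is positive, [Q :\ x] is acyclic in degree [k - 1], so each basis cycle [h2 j] of
   the link bounds there. *)
have /choice[w wP] : forall j : 'I_r2,
    exists w, clique_chain (Q :\ x) k w /\ bd w = h2 j.
  move=> j; have [cj zj] := h2c j.
  have /free_homology0P/(_ (h2 j)) := acQ (leq_ltn_trans (leq0n _) (ltn_ord j)).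
  case; first by split=> //; apply: clique_chainS LQ _.
  by move=> w; rewrite subrK => ? ?; exists w.
(* Two fillings of the same cycle, the cone and [w j], differ by a cycle of [Q] whose link part is
   [h2 j]. *)
pose h i := match split i with inl i1 => h1 i1 | inr j => cone x (h2 j) - w j end.
have hl i : h (lshift r2 i) = h1 i.
  by rewrite /h; case: split_ordP => j /eqP; rewrite ?eq_shift // => /eqP ->.
have hr j : h (rshift r1 j) = cone x (h2 j) - w j.
  by rewrite /h; case: split_ordP => i /eqP; rewrite ?eq_shift // => /eqP ->.
have h2r j : rest x (h2 j) = h2 j by apply: clique_chain_rest_id (h2c j).1.
have lp0 c k' : clique_chain (Q :\ x) k' c -> link_part x c = 0.
  by move=> /(clique_chain_rest_id xQ') <-; rewrite link_part_rest.
have sumh a : \sum_i h i *~ a i =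
    \sum_i h1 i *~ a (lshift r2 i) - \sum_j w j *~ a (rshift r1 j)
      + cone x (\sum_j h2 j *~ a (rshift r1 j)).
  rewrite big_split_ord /= -addrA; congr (_ + _).
    by apply: eq_bigr => i _; rewrite hl.
  rewrite [cone x _]raddf_sum addrC -sumrB; apply: eq_bigr => j _.
  by rewrite hr raddfMz mulrzBl.
exists h.
  move=> i; rewrite /h; case: split => [i1|j].
    by have [c1 z1] := h1c i1; split=> //; exact: clique_chainS QQ c1.
  have [cj zj] := h2c j; have [cw zw] := wP j; split.
    apply: clique_chainB; last exact: clique_chainS QQ cw.
    by rewrite -[k](subrK 1); exact: clique_chain_cone.
  by rewrite raddfB /= bd_cone // zj raddf0 subr0 zw subrr.
split.
- move=> z [cz z0].
  have zb : bd (rest x z) = - link_part x z.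
    by have /esym/eqP := rest_bd x z; rewrite z0 raddf0 addr_eq0 => /eqP.
  have [|a2 [u cu bu]] := gen2 (link_part x z).
    split; first exact: clique_chain_link_part.
    by have /eqP := link_part_bd x z; rewrite z0 raddf0 eq_sym oppr_eq0 => /eqP.
  rewrite subrK in cu.
  have ru : rest x u = u by exact: clique_chain_rest_id cu.
  (* This is [z] minus the combination of the [cone x (h2 j) - w j] plus [bd (cone x u)]: a cycle
     homologous to what is left of [z], but off [x]. *)
  pose z' := rest x z + \sum_j w j *~ a2 j + u.
  have [|a1 [t ct bt]] := gen1 z'.
    split.
      apply: clique_chainD; last exact: clique_chainS LQ cu.
      apply: clique_chainD; first exact: clique_chain_rest.
      by apply: clique_chain_comb => j; exact: (wP j).1.
    rewrite !raddfD /= zb bu raddf_sum /=.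
    rewrite (eq_bigr (fun j => h2 j *~ a2 j)); last first.
      by move=> j _; rewrite raddfMz /= (wP j).2.
    by rewrite -addrA subrKC addNr.
  pose a i := match split i with inl i1 => a1 i1 | inr j => a2 j end.
  have al i : a (lshift r2 i) = a1 i by rewrite /a (unsplitK (inl i)).
  have ar j : a (rshift r1 j) = a2 j by rewrite /a (unsplitK (inr j)).
  exists a; exists (t - cone x u).
    apply: clique_chainB; first exact: clique_chainS QQ ct.
    exact: clique_chain_cone.
  rewrite sumh [bd _]raddfB /= bd_cone // bt bu -[z in RHS](rest_link_partK x).
  rewrite [X in _ - (X - _ + _)](eq_bigr (fun i => h1 i *~ a1 i)); last by move=> i _; rewrite al.
  rewrite [X in _ - (_ - X + _)](eq_bigr (fun j => w j *~ a2 j)); last first.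
    by move=> j _; rewrite ar.
  rewrite [X in _ - (_ - _ + cone x X)](eq_bigr (fun j => h2 j *~ a2 j)); last first.
    by move=> j _; rewrite ar.
  rewrite [cone x (_ - _)]raddfB /= /z'; set s1 := \sum_i _ *~ _; set s2 := \sum_i _ *~ _.
  move: (rest x z) (cone x _) (cone x _) => p q s; apply/ffunP => A.
  by rewrite !ffunE; ring.
- move=> a; rewrite sumh => -[c cc bc].
  set s1 := \sum_i _ in bc; set s2 := \sum_i _ in bc; set s3 := \sum_i _ in bc.
  have cs1 : clique_chain (Q :\ x) k s1.
    by apply: clique_chain_comb => i; exact: (h1c i).1.
  have cs2 : clique_chain (Q :\ x) k s2.
    by apply: clique_chain_comb => i; exact: (wP i).1.
  have cs3 : clique_chain (link x Q) (k - 1) s3.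
    by apply: clique_chain_comb => i; exact: (h2c i).1.
  have lc := clique_chain_link_part (x := x) cc.
  (* Taking link parts of the relation kills all terms off [x] and leaves a relation among the
     [h2 j], so that [ind2] applies. *)
  have bs3 : bd (link_part x c) = - s3.
    apply: oppr_inj; rewrite -link_part_bd bc raddfD raddfB /= (lp0 _ _ cs1).
    rewrite (lp0 _ _ cs2) link_part_cone ?opprK ?subrr ?add0r //.
    exact: clique_chain_rest_id cs3.
  have a2 : forall j, a (rshift r1 j) = 0.
    apply: ind2; exists (- link_part x c); last by rewrite raddfN /= bs3 opprK.
    by apply: clique_chainN; rewrite addrAC in lc.
  have s20 : s2 = 0 by rewrite /s2 big1 // => j _; rewrite a2 mulr0z.
  have s30 : s3 = 0 by rewrite /s3 big1 // => j _; rewrite a2 mulr0z.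
  suff a1 : forall i, a (lshift r2 i) = 0.
    by move=> i; rewrite -(splitK i); case: (split i) => j /=.
  apply: (ind1 (fun i => a (lshift r2 i))); case: (posnP r1) => [r10|r1_gt0].
    suff -> : \sum_i h1 i *~ a (lshift r2 i) = 0 by exact: clique_bdry0.
    by rewrite big1 // => i; have i_r1 := ltn_ord i; exfalso; lia.
  (* With the [h2] terms gone, [link_part x c] is a cycle, hence [bd u] for some [u] in the link;
     then [rest x c + u] avoids [x] and still bounds the combination of the [h1 i]. *)
  have /free_homology0P/(_ (link_part x c)) := acL r1_gt0.
  case; first by split; [rewrite addrK in lc | rewrite bs3 s30 oppr0].
  move=> u cu bu; exists (rest x c + u).
    apply: clique_chainD; first exact: clique_chain_rest.
    exact: clique_chainS LQ cu.
  rewrite raddfD /= bu -rest_bd bc s20 s30 subr0 raddf0 addr0.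
  exact: clique_chain_rest_id cs1.
Qed.

(* Each vertex [x] of [Q] outside [R] is dominated by some [y] once the
   vertices of larger height are removed, so its link is a cone. *)
Lemma retract_free_homology (height : V -> nat) Q R k r : R \subset Q ->
  {in Q :\: R, forall x, exists2 y, y \in R & [/\ y != x, e x y &
     forall v, v \in Q -> e x v -> (v \in R) || (height v <= height x)%N -> e y v]} ->
  free_homology R k r -> free_homology Q k r.
Proof.
have [n] := ubnP #|Q :\: R|; elim: n Q => // n IHn Q; rewrite ltnS => leQn RQ dom hR.
have [QR0|[x0 x0Q]] := set_0Vmem (Q :\: R).
  suff -> : Q = R by [].
  by apply/eqP; rewrite eqEsubset RQ -setD_eq0 QR0 eqxx.
(* Maximality of the height makes the domination hypothesis apply to every neighbour of [x] in [Q],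
   so [y] is an apex of the link. *)
case: (arg_maxnP height x0Q) => x xQR xmax.
have {}xQR : x \in Q :\: R := xQR; have /setDP[xQ xR] := xQR.
have [y yR [yx exy ydom]] := dom x xQR.
have yQ : y \in Q by exact: (subsetP RQ).
have acyc k' : free_homology (link x Q) k' 0.
  apply: (@cone_free_homology _ _ y); first by rewrite !inE yQ yx.
  move=> v; rewrite !inE => /and3P[vQ vx exv]; apply: ydom => //.
  have [//|vR] := boolP (v \in R); apply: xmax; exact/setDP.
rewrite -[r]addn0; apply: (free_homology_add_vertex xQ) => //.
- apply: IHn => //; last 1 first.
  + move=> v /setDP[/setD1P[vx vQ] vR].
    have [|y' y'R [y'v evy' y'dom]] := dom v; first by rewrite !inE vR.
    exists y' => //; split=> // v' /setD1P[_ v'Q]; exact: y'dom.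
  + apply: leq_trans leQn; rewrite (cardsD1 x (Q :\: R)) xQR add1n ltnS.
    by apply: subset_leq_card; apply/subsetP => v; rewrite !inE => /and3P[-> -> ->].
  + by rewrite subsetD1 RQ.
Qed.

End CliqueHomology.

(** * From clique chains to the reduced homology groups *)

Definition Z_basis (W : zmodType) (r : nat) (h : 'I_r -> W) :=
  (forall v, exists a : 'I_r -> int, v = \sum_i h i *~ a i) /\ Z_independent h.

Section HomologyOfCliqueComplex.
Variables (V : finType) (e : rel V) (Q : {set V}) (K : simplicial_complex V).
Hypothesis facesK : forall A : {set V},
  (A \in faces K) = (A \subset Q) && clique e A.
Local Notation gchain := {ffun {set V} -> int}.
Implicit Types (A B : {set V}) (k l : int).

Definition restrict_chain k (c : gchain) : chain K k := [ffun A => c (val A)].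
Definition extend_chain k (c : chain K k) : gchain :=
  [ffun A : {set V} =>
     oapp (fun F : face K k => c F) (0 : int) (insub A)].

Fact extend_chain_is_zmod_morphism k : zmod_morphism (@extend_chain k).
Proof.
by move=> c c'; apply/ffunP => A; rewrite !ffunE; case: insub => [F|];
  rewrite /= ?subr0 ?ffunE.
Qed.
HB.instance Definition _ k := GRing.isZmodMorphism.Build (chain K k) gchain
  (@extend_chain k) (@extend_chain_is_zmod_morphism k).

Lemma faceE k A : (A \in faces K) && (#|A|%:Z == k + 1) = cface e Q k A.
Proof. by rewrite facesK -andbA. Qed.

Lemma extend_chainK k : cancel (@extend_chain k) (@restrict_chain k).
Proof. by move=> c; apply/ffunP => F; rewrite !ffunE valK. Qed.

Lemma extend_chainP k (c : chain K k) : clique_chain e Q k (extend_chain c).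
Proof. by move=> A; rewrite ffunE; case: insubP => [F|]; rewrite ?faceE ?eqxx. Qed.

Lemma restrict_chainK k c : clique_chain e Q k c ->
  extend_chain (restrict_chain k c) = c.
Proof.
move=> /clique_chainP cQ; apply/ffunP => A; rewrite ffunE.
case: insubP => [F _ <-|] /=; first by rewrite ffunE.
by rewrite faceE => /cQ ->.
Qed.

Lemma bd_extend k l (c : chain K k) : l + 1 = k ->
  bd (extend_chain c) = extend_chain (boundary l c).
Proof.
move=> lk; apply/ffunP => B; rewrite [in RHS]ffunE; case: insubP => [F _ <-|nB] /=.
  rewrite !ffunE (bigID (mem [set A | (A \in faces K) && (#|A|%:Z == k + 1)])) /=.
  rewrite addrC big1 => [|A]; last first.
    by rewrite inE ffunE; case: insubP => [G ->|_ _]; rewrite ?mulr0.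
  rewrite add0r (reindex_omap (val : face K k -> {set V}) insub) => [|A]; last first.
    by rewrite inE => pA; rewrite insubT.
  apply: eq_big => [A|A _]; first by rewrite inE valK eqxx (valP A).
  by rewrite ffunE valK.
(* If [B] is not a face of degree [l], no [v |: B] is a face of degree [l + 1], since faces are
   closed under subsets. *)
rewrite bdE big1 // => v vB; suff -> : extend_chain c (v |: B) = 0 by rewrite mulr0.
rewrite ffunE; case: insubP => // F /andP[vK vk] _; case/negP: nB; apply/andP; split.
  exact: faces_closed (subsetUr _ _) vK.
by move: vk; rewrite cardsU1 vB -lk; clear; lia.
Qed.

(** The given cycles, restricted to faces, represent a basis of the quotient, because extension by
    zero commutes with the boundary. *)
Lemma homology_basis k r : free_homology e Q k r ->
  exists h : 'I_r -> reduced_homology K k, Z_basis h.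
Proof.
case=> h hc [gen ind].
have hcyc i : restrict_chain k (h i) \in @is_cycle V K k.
  have [cc h0] := hc i; rewrite unfold_in /is_cycle -[X in X == _]extend_chainK.
  rewrite -bd_extend ?subrK // restrict_chainK // h0.
  by apply/eqP/ffunP => F; rewrite !ffunE.
pose z i : Defs.cycle K k := Cycle (hcyc i).
have extz a : extend_chain (val (\sum_i z i *~ a i)) = \sum_i h i *~ a i.
  rewrite !raddf_sum; apply: eq_bigr => i _.
  by rewrite !raddfMz /= restrict_chainK //; exact: (hc i).1.
exists (fun i => \pi_(reduced_homology K k) (z i)).
have piz a : \sum_i \pi_(reduced_homology K k) (z i) *~ a i =
    \pi_(reduced_homology K k) (\sum_i z i *~ a i).
  by rewrite raddf_sum; apply: eq_bigr => i _; rewrite raddfMz.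
split=> [v|a].
  have [|a [c cc bc]] := gen (extend_chain (val (repr v))).
    split; first exact: extend_chainP.
    rewrite (@bd_extend k (k - 1)) ?subrK //.
    by have /eqP -> := cycleP (repr v); rewrite raddf0.
  exists a; rewrite piz -[LHS]reprK; apply/eqP; rewrite -Quotient.idealrBE.
  apply/asboolP; exists (restrict_chain (k + 1) c).
  apply: (can_inj (@extend_chainK k)).
  rewrite -bd_extend // restrict_chainK // bc -extz -[LHS]raddfB.
  by congr (extend_chain _); rewrite raddfB.
rewrite piz => pi0.
have /eqP : \sum_i z i *~ a i = 0 %[mod reduced_homology K k] by rewrite pi0 raddf0.
rewrite -Quotient.idealrBE subr0 => /asboolP[c bc]; apply: ind.
exists (extend_chain c); first exact: extend_chainP.
by rewrite (@bd_extend (k + 1) k) // bc extz.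
Qed.

End HomologyOfCliqueComplex.

(** * Ranks of free abelian groups and of direct sums *)

(** More rows than columns leave a nonzero rational kernel vector; clearing its denominators gives
    the integer relation. *)
Lemma int_dependent_rows (I : finType) n (a : 'I_n -> I -> int) :
  (#|I| < n)%N -> exists2 u : 'I_n -> int,
    (forall j, \sum_i u i * a i j = 0) & exists i, u i != 0.
Proof.
move=> In; pose A : 'M[rat]_(n, #|I|) := \matrix_(i, j) (a i (enum_val j))%:~R.
have : kermx A != 0.
  by rewrite kermx_eq0 /row_free neq_ltn (leq_ltn_trans (rank_leq_col _) In).
move=> /rowV0Pn[v /sub_kermxP vA v0].
(* [D] is a common denominator, and [u i] is the integer equal to [D * v 0 i]. *)
pose D := \prod_i denq (v 0 i).
have D0 : D != 0 by apply/prodf_neq0 => i _; exact: denq_neq0.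
pose u i := numq (v 0 i) * \prod_(j | j != i) denq (v 0 j).
have uE i : (u i)%:~R = D%:~R * v 0 i :> rat.
  by rewrite /u /D [in RHS](bigD1 i) //= !intrM numqE; ring.
exists u.
  move=> j; apply: (@intr_inj rat); rewrite rmorph_sum rmorph0 /=.
  move/rowP/(_ (enum_rank j)): vA; rewrite !mxE => vA.
  apply: etrans (etrans _ (congr1 (fun q => D%:~R * q) vA)) (mulr0 _).
  rewrite mulr_sumr; apply: eq_bigr => i _.
  by rewrite rmorphM /= uE mxE enum_rankK mulrA.
move/rV0Pn: v0 => [i vi]; exists i.
by rewrite -(@intr_eq0 rat) uE mulf_neq0 // intr_eq0.
Qed.

(** Preimages of the unit vectors give an independent family of size [#|I|]; a longer family has an
    integer relation between its coordinate vectors. *)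
Lemma has_rank_coordinates (I : finType) (W : zmodType)
    (phi : W -> {ffun I -> int}) :
  zmod_morphism phi -> injective phi -> (forall a, exists v, phi v = a) ->
  has_rank W #|I|.
Proof.
move=> phiB phi_inj phi_surj.
pose HM := GRing.isZmodMorphism.Build _ _ phi phiB.
pose f : {additive W -> {ffun I -> int}} := HB.pack phi HM.
have fcomb n (v : 'I_n -> W) (a : 'I_n -> int) j :
    f (\sum_i v i *~ a i) j = \sum_i f (v i) j * a i.
  rewrite raddf_sum sum_ffunE; apply: eq_bigr => i _.
  by rewrite raddfMz ffun_mulzE mulrzz.
split.
  have /choice[w wE] : forall i : 'I_#|I|, exists v, phi v = [ffun j => (j == enum_val i)%:R].
    by move=> i; exact: phi_surj.
  exists w => a aw i; have := fcomb _ w a (enum_val i); rewrite aw raddf0 ffunE.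
  rewrite (bigD1 i) //= wE ffunE eqxx mul1r big1 ?addr0 // => i' i'i.
  by rewrite wE ffunE (inj_eq enum_val_inj) eq_sym (negPf i'i) mul0r.
move=> n v ind; rewrite leqNgt; apply/negP => /(int_dependent_rows (fun i => f (v i))).
move=> [u u0 [i /eqP]]; case; apply: ind; apply: phi_inj.
rewrite -[phi _]/(f _) -[phi 0]/(f 0) raddf0; apply/ffunP => j.
by rewrite fcomb ffunE -[RHS](u0 j); apply: eq_bigr => i' _; rewrite mulrC.
Qed.

(** Coordinates in chosen bases of the summands combine into coordinates indexed by the disjoint
    union of the bases; their uniqueness makes them additive. *)
Lemma has_rank_direct_sum (I : finType) (W : I -> zmodType) (r : I -> nat)
    (h : forall s, 'I_(r s) -> W s) :
  (forall s, Z_basis (h s)) -> has_rank (direct_sum W) (\sum_s r s).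
Proof.
move=> hb.
pose coord s v : 'I_(r s) -> int := projT1 (cid ((hb s).1 v)).
have coordE s v : v = \sum_i h s i *~ coord s v i by rewrite /coord; case: cid.
have coord_uniq s (a b : 'I_(r s) -> int) :
    \sum_i h s i *~ a i = \sum_i h s i *~ b i -> forall i, a i = b i.
  move=> ab i; apply/eqP; rewrite -subr_eq0; apply/eqP.
  apply: ((hb s).2 (fun i => a i - b i)); under eq_bigr do rewrite mulrzBr.
  by rewrite sumrB ab subrr.
have -> : (\sum_s r s)%N = #|{: {s : I & 'I_(r s)}}|.
  rewrite card_tagged sumnE big_map -big_enum /=.
  by apply: eq_bigr => s _; rewrite card_ord.
apply: (@has_rank_coordinates _ _ (fun v : direct_sum W =>
  [ffun p : {s : I & 'I_(r s)} => coord (tag p) (v (tag p)) (tagged p)])).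
- move=> v w; apply/ffunP => -[s i]; rewrite !ffunE /=.
  apply: (coord_uniq s _ (fun i => coord s (v s) i - coord s (w s) i)).
  under [RHS]eq_bigr do rewrite mulrzBr.
  by rewrite sumrB -!coordE.
- move=> v w /ffunP vw; apply/ffunP => s; rewrite [LHS]coordE [RHS]coordE.
  by apply: eq_bigr => i _; have := vw (Tagged (fun s => 'I_(r s)) i); rewrite !ffunE /= => ->.
- move=> a; exists [ffun s => \sum_i h s i *~ a (Tagged (fun s => 'I_(r s)) i) : W s].
  apply/ffunP => -[s i]; rewrite !ffunE /=.
  apply: (coord_uniq s _ (fun i => a (Tagged (fun s => 'I_(r s)) i))).
  by rewrite -coordE.
Qed.

(** * Alternating sums over intervals of sets *)

Section SignedSums.
Variables (E : finType) (p : pred {set E}).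
Implicit Types (C S T : {set E}).

Definition signed_sum C T : int :=
  \sum_(S : {set E} | [&& C \subset S, S \subset T & p S]) (-1) ^+ #|S|.

Lemma signed_sumxx T : p T -> signed_sum T T = (-1) ^+ #|T|.
Proof.
move=> pT; rewrite /signed_sum (big_pred1 T) // => S.
rewrite andbA [X in X && _]andbC -eqEsubset /=; case: eqP => //= ->; exact: pT.
Qed.

(** The counterpart for signed sums of removing the vertex [T :\ e]. *)
Lemma signed_sum_split C T e : e \in T -> e \notin C ->
  signed_sum C T = signed_sum C (T :\ e) + signed_sum (e |: C) T.
Proof.
move=> eT eC; rewrite /signed_sum (bigID (fun S : {set E} => e \in S)) /= addrC.
congr (_ + _); apply: eq_bigl => S.
  by rewrite subsetD1; case: (_ \subset S); case: (S \subset T); case: (p S);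
     case: (e \in S).
by rewrite subUset sub1set; case: (C \subset S); case: (S \subset T); case: (p S);
     case: (e \in S).
Qed.

(** Adding or deleting [e] is then a sign-reversing involution on the summands. *)
Lemma signed_sum_cancel C T e : e \in T -> e \notin C ->
  (forall S, C \subset S -> S \subset T -> e \in S -> p (S :\ e) = p S) ->
  signed_sum C T = 0.
Proof.
move=> eT eC pe; rewrite (signed_sum_split eT eC) addrC.
apply/eqP; rewrite addr_eq0 /signed_sum; apply/eqP.
rewrite (reindex_onto (fun S => e |: S) (fun S => S :\ e)) /=; last first.
  by move=> S /and3P[]; rewrite subUset sub1set => /andP[eS _] _ _; rewrite setD1K.
rewrite -sumrN; apply: eq_big => [S|S /andP[_ /eqP SE]]; last first.
  have eS : e \notin S by rewrite -SE setD11.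
  by rewrite cardsU1 eS exprS mulN1r.
have [eS|eS] := boolP (e \in S).
  rewrite [S \subset _]subsetD1 eS !andbF /=; apply/negP => /andP[_ /eqP SE].
  by move: eS; rewrite -SE setD11.
rewrite setU1K // eqxx andbT [S \subset _]subsetD1 eS andbT !subUset !sub1set setU11 eT.
have -> /= : (C \subset e |: S) = (C \subset S).
  apply/idP/idP => [/subsetP h|h]; last exact: subset_trans h (subsetUr _ _).
  apply/subsetP => x xC; have /setU1P[xe|//] := h x xC.
  by rewrite xe (negPf eC) in xC.
have [CS|//] := boolP (C \subset S); have [ST|//] := boolP (S \subset T) => /=.
rewrite -(pe (e |: S)) ?setU1K ?setU11 //; first exact: subset_trans CS (subsetUr _ _).
by rewrite subUset sub1set eT.
Qed.

End SignedSums.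

(** * Homology of truncated intervals of the Boolean lattice *)

Section TruncatedIntervals.
Variables (E : finType) (M : matroid E) (i : nat).
Implicit Types (A B C S T U : {set E}).
Local Notation r := (mrank M - i)%N.
Local Notation comp := (fun x y : L_poset M i => (x >=< y)%O).

(** Submodularity for [B] and [e |: A], which meet in [A] when [e] is not in [B]: the gain in rank
    from [e] shrinks as the set grows. *)
Lemma rk_setU1_diminish A B e : A \subset B ->
  (M (e |: B) + M A <= M B + M (e |: A))%N.
Proof.
move=> AB; have [eB|eB] := boolP (e \in B).
  by rewrite (setUidPr _) ?sub1set // leq_add2l rk_mono ?subsetUr.
have := rk_submod M B (e |: A).
have -> : B :|: (e |: A) = e |: B by rewrite setUCA (setUidPl AB).
suff -> : B :&: (e |: A) = A by [].
by apply/setP => x; rewrite !inE; case: eqP => [->|_] /=;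
  [rewrite (negPf eB); apply/esym/negbTE; apply: contra eB; apply: (subsetP AB) |
   apply: andb_idl; apply: (subsetP AB)].
Qed.

Lemma rk_setU1_le A e : (M (e |: A) <= (M A).+1)%N.
Proof.
have := rk_submod M [set e] A; have := rk_card M [set e]; rewrite cards1; lia.
Qed.

Lemma in_S_mono A B : A \subset B -> in_S M i A -> in_S M i B.
Proof. by move=> /(rk_mono M) AB; rewrite /in_S => /leq_trans; apply. Qed.

(** Closed at [C], open at [T], and without the bottom. Its elements live in [L_poset], the vertex
    type of the order complexes; for empty [C] it is the open interval below [T]. *)
Definition between C T : {set L_poset M i} :=
  [set x : L_poset M i |
     if x is Some U then (C \subset set_of_S U) && (set_of_S U \proper T) else false].

Lemma in_between C T (S : S_poset M i) : (Some S \in between C T) =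
  (C \subset set_of_S S) && (set_of_S S \proper T).
Proof. by rewrite inE. Qed.

Lemma L_compE (A B : S_poset M i) :
  ((Some A : L_poset M i) >=< Some B)%O =
  (set_of_S A \subset set_of_S B) || (set_of_S B \subset set_of_S A).
Proof. by []. Qed.

Definition L_card (x : L_poset M i) : nat :=
  if x is Some U then #|set_of_S U| else 0.

Lemma comp_refl : reflexive comp. Proof. by move=> x; exact: comparablexx. Qed.
Lemma comp_sym : symmetric comp. Proof. by move=> x y; exact: comparable_sym. Qed.

(** A member avoiding [e] would lie in [T :\ e], whose rank is too small. *)
Lemma between_coloop C T e : e \in T -> ~~ in_S M i (T :\ e) ->
  between C T = between (e |: C) T.
Proof.
move=> eT nT; apply/setP => -[S|]; last by rewrite !inE.
rewrite !in_between subUset sub1set; case ST: (_ \proper T); rewrite ?andbF // !andbT.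
suff -> : e \in set_of_S S by [].
apply: contraNT nT => eS; apply: in_S_mono (S_posetP S).
by rewrite subsetD1 eS (proper_sub ST).
Qed.

(** The map [S |-> S :\ e] retracts onto the members avoiding [e], and [T :\ e] is the largest of
    these, hence an apex. *)
Lemma between_contractible C T e k : e \in T -> e \notin C -> C \subset T ->
  in_S M i T ->
  (forall S, C \subset S -> S \subset T -> in_S M i S -> in_S M i (S :\ e)) ->
  free_homology comp (between C T) k 0.
Proof.
move=> eT eC CT iT pe.
have eqX (A : {set E}) (h h' : in_S M i A) : SPoset h = SPoset h' by exact: val_inj.
pose R := [set x in between C T | if x is Some U then e \notin set_of_S U else true].
(* The height decreases with size, so the smallest sets containing [e] go first: a remaining set
   below [S] either avoids [e] or equals [S]. *)
apply: (retract_free_homology comp_refl comp_sym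
          (height := fun x => (#|E| - L_card x)%N) (R := R)).
- by apply/subsetP => x; rewrite inE => /andP[].
- move=> -[S|]; last by rewrite !inE.
  rewrite inE [_ \in R]inE; case SQ: (_ \in between _ _); rewrite ?andbF //=.
  rewrite andbT negbK => eS; move: SQ; rewrite in_between => /andP[CS ST].
  have iS := pe _ CS (proper_sub ST) (S_posetP S).
  have CS' : C \subset set_of_S S :\ e by rewrite subsetD1 CS.
  exists (Some (SPoset iS)).
    rewrite inE in_between /= CS' setD11 andbT.
    by apply: sub_proper_trans ST; exact: subD1set.
  split.
  + by apply/eqP => -[] SE; move: eS; rewrite -SE /= setD11.
  + by rewrite L_compE /= subD1set orbT.
  move=> -[U|]; last by rewrite inE.
  move=> UQ; rewrite [_ \in R]inE UQ !L_compE /= subsetD1.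
  have US1 := subD1set (set_of_S S) e.
  have cE B : (#|B| <= #|E|)%N := max_card _.
  move=> /orP[SU|US] h; first by rewrite (subset_trans US1 SU).
  case/orP: h => [->|h]; first by rewrite US orbT.
  have /eqP -> : set_of_S U == set_of_S S.
    by move: h; rewrite /L_card leq_sub2lE ?cE // eqEcard US.
  by rewrite US1.
have iTe := pe _ CT (subxx T) iT.
apply: (@cone_free_homology _ _ comp_refl comp_sym _ _ (Some (SPoset iTe))).
  by rewrite inE in_between /= subsetD1 CT eC properD1 // setD11.
move=> [U|]; rewrite !inE //= => /andP[/andP[_ UT] eU].
by rewrite L_compE /= subsetD1 (proper_sub UT) eU orbT.
Qed.

(** No set lies strictly between [T :\ e] and [T], so the other members comparable with [T :\ e] are
    those below it. *)
Lemma link_between C T e (iTe : in_S M i (T :\ e)) : e \in T ->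
  link comp (Some (SPoset iTe)) (between C T) = between C (T :\ e).
Proof.
move=> eT; apply/setP => -[S|]; last by rewrite !inE.
rewrite inE !in_between L_compE /= (inj_eq (@Some_inj _)) -(inj_eq val_inj) /=.
rewrite properEneq [_ \proper _ :\ e]properEneq.
have [->|SE] /= := eqVneq (set_of_S S) (T :\ e); first by rewrite ?andbF.
rewrite subsetD1; have [CS|] := boolP (C \subset set_of_S S) => //=.
have [ST|] /= := boolP (_ \subset T); last by rewrite ?andbF.
have [eS|eS] := boolP (e \in set_of_S S); rewrite ?orbT ?orbF ?andbT ?andbF //=.
  apply/negP => /andP[/eqP nT TS]; apply: nT; apply/eqP; rewrite eqEsubset ST.
  by rewrite -(setD1K eT) subUset sub1set eS.
by apply: contraNneq eS => ->.
Qed.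

(** The map [S |-> e |: S] stays properly inside [T] once [T :\ e] is removed. Here the largest sets
    avoiding [e] go first. *)
Lemma between_del_retract C T e (iTe : in_S M i (T :\ e)) k n : e \in T ->
  free_homology comp (between (e |: C) T) k n ->
  free_homology comp (between C T :\ Some (SPoset iTe)) k n.
Proof.
move=> eT; apply: (retract_free_homology comp_refl comp_sym (height := L_card)).
  apply/subsetP => -[S|]; last by rewrite !inE.
  rewrite in_setD1 !in_between subUset sub1set => /andP[/andP[eS ->] ->] /=.
  by rewrite andbT; apply: contraTneq eS => -[->]; rewrite setD11.
move=> -[S|]; last by rewrite !inE.
rewrite in_setD in_setD1 !in_between subUset sub1set (inj_eq (@Some_inj _)).
rewrite -(inj_eq val_inj) /= => /andP[+ /and3P[STe CS ST]].
rewrite CS ST !andbT => eS.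
have iS : in_S M i (e |: set_of_S S) by apply: in_S_mono (S_posetP S); exact: subsetUr.
exists (Some (SPoset iS)).
  rewrite in_between /= setUS //= properEneq subUset sub1set eT (proper_sub ST) andbT.
  by rewrite andbT; apply: contraNneq STe => <-; rewrite setU1K.
split.
- by apply/eqP => -[] SE; move: eS; rewrite -SE /= setU11.
- by rewrite L_compE /= subsetUr.
move=> -[U|]; last by rewrite !inE.
rewrite in_setD1 !in_between !L_compE /= subUset sub1set.
move=> /andP[_ /andP[CU UT]] /orP[SU|US] h; last first.
  by rewrite (subset_trans US) ?orbT // subsetUr.
case/orP: h => [/andP[]|h].
  by rewrite subUset sub1set => /andP[-> _] _; rewrite SU.
have /eqP <- : set_of_S S == set_of_S U by rewrite eqEcard SU.
by rewrite subsetUr orbT.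
Qed.

(** The induction passes from [C] to [e |: C] only when the rank grows too, so sign and degree are
    unchanged; passing to [T :\ e] lowers the degree by one, as the link requires. *)
Lemma between_homology C T : C \subset T -> (M C <= r)%N -> in_S M i T ->
  exists2 n : nat,
    (-1) ^+ (#|C| + M C + r) * signed_sum (in_S M i) C T = n%:Z &
    forall k, free_homology comp (between C T) k
      (if k == #|T|%:Z - #|C|%:Z + (M C)%:Z - r%:Z - 1 then n else 0%N).
Proof.
have [n] := ubnP #|T :\: C|; elim: n C T => // n IHn C T; rewrite ltnS => le_n CT Cr iT.
have [TC0|[e]] := set_0Vmem (T :\: C).
  (* Here [M C = r] and the interval is empty: rank one in degree -1. *)
  have {}TC : T = C by apply/eqP; rewrite eqEsubset CT -setD_eq0 TC0 eqxx.
  subst T; exists 1%N.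
    have -> : M C = r by apply/eqP; rewrite eqn_leq Cr.
    by rewrite signed_sumxx // -exprD -signr_odd !oddD; do 2!case: (odd _).
  move=> k; have -> : between C C = set0.
    apply/setP => -[S|]; rewrite !inE //.
    by apply/negbTE/negP => /andP[CS /andP[_ /negP]].
  have -> : #|C|%:Z - #|C|%:Z + (M C)%:Z - r%:Z - 1 = -1.
    by have := iT; rewrite /in_S; lia.
  exact: free_homology_set0.
rewrite inE => /andP[eC eT].
have cardC : #|e |: C| = #|C|.+1 by rewrite cardsU1 eC.
have cardT : #|T| = #|T :\ e|.+1 by rewrite [LHS](cardsD1 e) eT.
have eCT : e |: C \subset T by rewrite subUset sub1set eT.
have CTe : C \subset T :\ e by rewrite subsetD1 CT.
have [h1 h2] : (#|(T :\ e) :\: C| < n)%N /\ (#|T :\: (e |: C)| < n)%N.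
  have h : (#|(T :\: C) :\ e| < n)%N.
    by move: le_n; rewrite (cardsD1 e) inE eC eT.
  by split; [rewrite setDDl setUC -setDDl | rewrite setDDl setUC in h].
have [nTe|iTe] := boolP (~~ in_S M i (T :\ e)).
  (* As [e] raises the rank of [T :\ e], it raises that of the smaller set [C]; and [M C < r] leaves
     room for this. *)
  have Me := rk_setU1_diminish e CTe; rewrite setD1K // in Me.
  have Me' := rk_setU1_le C e; have MTe := rk_mono M CTe.
  have MeC : M (e |: C) = (M C).+1.
    by clear -Me Me' iT nTe; rewrite /in_S in iT nTe; lia.
  have [|n1 sn1 hn1] := IHn _ _ h2 eCT _ iT.
    by clear -MTe MeC nTe; rewrite /in_S in nTe; lia.
  exists n1 => [|k].
    rewrite -sn1 (signed_sum_split _ eT eC) [X in X + _]big_pred0 ?add0r => [|S].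
      by rewrite cardC MeC addSnnS !addnS !addSn !exprS mulrA mulN1r opprK mul1r.
    apply/negbTE; apply: contra nTe => /and3P[_]; exact: in_S_mono.
  rewrite (between_coloop _ eT nTe); have := hn1 k.
  rewrite cardC MeC; congr (free_homology _ _ _ (if k == _ then _ else _)); clear; lia.
rewrite negbK in iTe.
have [/forallP pe|] := boolP [forall S : {set E},
    [&& C \subset S, S \subset T & in_S M i S] ==> in_S M i (S :\ e)].
  have pe' S : C \subset S -> S \subset T -> in_S M i S -> in_S M i (S :\ e).
    by move=> CS ST iS; have := pe S; rewrite CS ST iS.
  exists 0%N.
    rewrite (signed_sum_cancel eT eC) ?mulr0 // => S CS ST _.
    by apply/idP/idP; [apply: in_S_mono; exact: subD1set | exact: pe'].
  by move=> k; rewrite if_same; exact: between_contractible pe'.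
rewrite negb_forall => /existsP[S]; rewrite negb_imply -!andbA => /and4P[CS ST iS nS].
have eS : e \in S.
  apply: contraR nS => eS; suff -> : S :\ e = S by [].
  by apply/setDidPl; rewrite disjoint_sym disjoints1.
have CSe : C \subset S :\ e by rewrite subsetD1 CS.
(* The witness [S] plays the role of [T]: [e] raises the rank of [S :\ e], which contains [C] and
   has rank below [r]. *)
have Me := rk_setU1_diminish e CSe; rewrite setD1K // in Me.
have Me' := rk_setU1_le C e; have MSe := rk_mono M CSe.
have MeC : M (e |: C) = (M C).+1.
  by clear -Me Me' iS nS; rewrite /in_S in iS nS; lia.
have eCr : (M (e |: C) <= r)%N.
  by clear -MSe MeC nS; rewrite /in_S in nS; lia.
have [n1 sn1 hn1] := IHn _ _ h1 CTe Cr iTe.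
have [n2 sn2 hn2] := IHn _ _ h2 eCT eCr iT.
exists (n2 + n1)%N.
  rewrite (signed_sum_split _ eT eC) mulrDr sn1 PoszD -sn2 cardC MeC addrC.
  by rewrite addSnnS !addnS !addSn !exprS mulrA mulN1r opprK mul1r.
move=> k; set D := _ - 1.
have hQ k' : free_homology comp (between C T :\ Some (SPoset iTe)) k'
    (if k' == D then n2 else 0%N).
  apply: (between_del_retract _ eT); have := hn2 k'.
  rewrite cardC MeC; congr (free_homology _ _ _ (if k' == _ then _ else _)).
  by clear; lia.
have hL k' : free_homology comp (link comp (Some (SPoset iTe)) (between C T)) k'
    (if k' == D - 1 then n1 else 0%N).
  rewrite (link_between _ iTe eT); have := hn1 k'.
  congr (free_homology _ _ _ (if k' == _ then _ else _)).
  by rewrite /D cardT; clear; lia.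
(* The deletion has homology only in degree [D] and the link only in degree [D - 1], so the
   neighbouring terms of the exact sequence vanish. *)
clearbody D; have Dsub : (D == D - 1) = false by clear; lia.
have -> : (if k == D then (n2 + n1)%N else 0%N) =
    addn (if k == D then n2 else 0%N) (if k - 1 == D - 1 then n1 else 0%N).
  by rewrite (inj_eq (addIr _)); case: eqP.
apply: (@free_homology_add_vertex _ _ comp_refl comp_sym _ k (Some (SPoset iTe))) => //.
- by rewrite in_between /= CTe properD1.
- by case: eqP => // -> _; have := hL D; rewrite Dsub.
- case: eqP => // /addIr -> _; have := hQ (D - 1).
  by rewrite eq_sym Dsub.
Qed.

End TruncatedIntervals.

(** * The Möbius function of the truncation as a signed sum *)

Section MoebiusOfTruncation.
Variables (E : finType) (M : matroid E) (i : nat).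
Implicit Types (S T U : {set E}).
Local Notation inS := (in_S M i).

(** Carries both integer sums of Möbius values and natural sums of ranks over to subsets of [E]; the
    bottom contributes the neutral element. *)
Lemma big_L_poset (R : Type) (idx : R) (op : Monoid.com_law idx)
    (P : pred {set E}) (G : {set E} -> R) :
  \big[op/idx]_(x : L_poset M i | if x is Some A then P (set_of_S A) else false)
     (if x is Some A then G (set_of_S A) else idx) =
  \big[op/idx]_(A | inS A && P A) G A.
Proof.
rewrite (reindex_omap (Some : S_poset M i -> L_poset M i) id) => [|[A|]] //=.
rewrite [RHS](reindex_omap (@set_of_S E M i) insub) => [|A /andP[iA _]]; last first.
  by rewrite insubT.
apply: eq_bigl => A.
by rewrite (valK A : insub (set_of_S A) = Some A) eqxx (S_posetP A) !andbT.
Qed.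

Lemma L_poset_ltE (A B : S_poset M i) :
  ((Some A : L_poset M i) < Some B)%O = (set_of_S A \proper set_of_S B).
Proof. by rewrite lt_neqAle properEneq. Qed.

Lemma moebius_L_out A : ~~ inS A -> moebius_L M i A = 0.
Proof. by move=> nA; rewrite /moebius_L insubF //; exact: negbTE. Qed.

(** The Möbius values from the bottom up to [T] sum to zero and the bottom has value 1. If [T] is
    outside the truncation, so are its subsets, where [moebius_L] is 0. *)
Lemma sum_moebius_L T : \sum_(A : {set E} | A \subset T) moebius_L M i A = - (inS T)%:R.
Proof.
have [iT|nT] := boolP (inS T); last first.
  rewrite big1 ?oppr0 // => A AT; apply: moebius_L_out.
  by apply: contra nT; exact: in_S_mono.
rewrite (bigD1 T) //= {1}/moebius_L insubT moebius_lt //.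
rewrite (bigD1 (\bot : L_poset M i)%O) //= moebiusxx opprD -addrA [_ + \sum_(_ | _) _]addrC.
set s := \sum_(_ | _) _; set s' := \sum_(_ | _) _.
suff -> : s' = s by rewrite addrN addr0.
rewrite /s' /s.
transitivity (\sum_(A | inS A && (A \proper T)) moebius_L M i A).
  rewrite -big_L_poset; apply: eq_big => [[A|]|[A|]] //=.
    by rewrite andbT L_poset_ltE.
  by move=> _; rewrite /moebius_L (valK A : insub (set_of_S A) = Some A).
rewrite big_mkcondl; apply: eq_big => A.
  by rewrite properEneq andbC.
by move=> _; case: ifP => // /negbT/moebius_L_out.
Qed.

Lemma signed_sum_all U T : U \subset T ->
  signed_sum predT U T = if U == T then (-1) ^+ #|T| else 0.
Proof.
move=> UT; case: eqP => [->|/eqP nUT]; first exact: signed_sumxx.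
have /properP[_ [e eT eU]] : U \proper T by rewrite properEneq nUT.
exact: signed_sum_cancel eT eU _.
Qed.

(** Möbius inversion on the Boolean lattice: insert [sum_moebius_L] for the indicator and exchange
    the sums; only [U = T] survives. *)
Lemma moebius_LE T : moebius_L M i T = - (-1) ^+ #|T| * signed_sum inS set0 T.
Proof.
have -> : signed_sum inS set0 T = - \sum_(S : {set E} | S \subset T)
    (-1) ^+ #|S| * \sum_(U : {set E} | U \subset S) moebius_L M i U.
  rewrite -sumrN /signed_sum; under eq_bigl do rewrite sub0set /=.
  rewrite big_mkcondr; apply: eq_bigr => S _; rewrite sum_moebius_L mulrN opprK.
  by case: (inS S); rewrite ?mulr1 ?mulr0.
under eq_bigr do rewrite mulr_sumr.
rewrite (exchange_big_dep (fun U : {set E} => U \subset T)) /=; last first.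
  by move=> S U ST US; exact: subset_trans US ST.
rewrite (bigD1 T) //= [X in _ + X]big1 => [|U /andP[UT nUT]]; last first.
  rewrite -mulr_suml [X in X * _](_ : _ = signed_sum predT U T).
    by rewrite signed_sum_all // (negPf nUT) mul0r.
  by apply: eq_bigl => S; rewrite andbT andbC.
rewrite addr0 -mulr_suml; set s := \sum_(_ | _) _; have -> : s = (-1) ^+ #|T|.
  rewrite -[RHS](_ : signed_sum predT T T = _); last by rewrite signed_sum_all ?eqxx.
  by apply: eq_bigl => S; rewrite andbT andbC.
by rewrite mulrNN mulrA -expr2 sqrr_sign mul1r.
Qed.

End MoebiusOfTruncation.

(** * Binomial identities as sums over subsets *)

Section SubsetGeneratingFunctions.
Variables (E : finType) (R : comNzRingType).
Implicit Types (S T J : {set E}) (x y : R).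

Lemma prod_if_set J (F G : E -> R) :
  \prod_i (if i \in J then F i else G i) =
  \prod_(i in J) F i * \prod_(i | i \notin J) G i.
Proof.
rewrite (bigID (mem J)) /=; congr (_ * _); apply: eq_bigr => i; first by move=> ->.
by move=> /negPf ->.
Qed.

Lemma prodr_const_notin S y : \prod_(i | i \notin S) y = y ^+ (#|E| - #|S|).
Proof.
rewrite (eq_bigl (mem (~: S))) => [|i]; last by rewrite /= in_setC.
by rewrite prodr_const cardsCs setCK.
Qed.

Lemma sum_subsets_exprD x y :
  \sum_(S : {set E}) x ^+ #|S| * y ^+ (#|E| - #|S|) = (x + y) ^+ #|E|.
Proof.
rewrite -[RHS]prodr_const (bigA_distr _ _ (fun=> x) (fun=> y)).
apply: eq_big => // S _; by rewrite prod_if_set prodr_const prodr_const_notin.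
Qed.

(** Expand the product of [x] over [S] and of [1 + x] off [S]; the indicator of [i \notin S] kills
    every choice [J] that misses an element of [S]. *)
Lemma sum_supersets S x :
  \sum_(T : {set E} | S \subset T) x ^+ #|T| = x ^+ #|S| * (1 + x) ^+ (#|E| - #|S|).
Proof.
have := @bigA_distr R 0 1 *%R +%R E (fun=> x) (fun i => (i \notin S)%:R).
have -> : \prod_i (x + (i \notin S)%:R) = x ^+ #|S| * (1 + x) ^+ (#|E| - #|S|).
  rewrite (eq_bigr (fun i => if i \in S then x else 1 + x)); last first.
    by move=> i _; case: (i \in S); rewrite ?addr0 // addrC.
  by rewrite prod_if_set prodr_const prodr_const_notin.
move=> ->; rewrite big_mkcond; apply: eq_big => // J _; rewrite prod_if_set prodr_const.
case: ifP => [SJ|/negbT/subsetPn[i iS iJ]].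
  rewrite big1 ?mulr1 // => i iJ.
  by rewrite (contra _ iJ) //; exact: (subsetP SJ).
by rewrite (bigD1 i) //= iS mul0r mulr0.
Qed.

End SubsetGeneratingFunctions.

(** * The polynomial form of [Yhat] and its coefficients *)

Section YhatPolynomial.
Variables (E : finType) (M : matroid E).
Implicit Types (S T A : {set E}).
Local Notation d := (mrank M).
Local Notation m := #|E|.

Lemma rk_le_mrank A : (M A <= d)%N.
Proof. exact: rk_mono (subsetT A). Qed.

Lemma mrank_le_card : (d <= m)%N.
Proof. by rewrite -cardsT; exact: rk_card. Qed.

(** Here ['X] stands for [p]; the outer variable of [Yhat_poly] stands for [t]. *)
Definition Yhat_coef (i : nat) : {poly int} :=
  (-1) ^+ (i + d) * \sum_(A | in_S M i A) (- 'X) ^+ #|A| * (1 + 'X) ^+ (m - #|A|).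

Definition Yhat_poly : polypt := \poly_(i < d) Yhat_coef i.

(** The arguments of the Tutte polynomial are chosen so that [x - 1 = q * t / (1 - q)] and
    [y - 1 = (1 - q) / q]; the prefactor then clears all denominators. *)
Lemma Y_term (K : fieldType) (q t : K) A : q != 0 -> 1 - q != 0 ->
  (1 - q) ^+ d * q ^+ (m - d) *
    (((q * t + 1 - q) / (1 - q) - 1) ^+ (d - M A) * (q^-1 - 1) ^+ corank M A) =
  (1 - q) ^+ #|A| * q ^+ (m - #|A|) * t ^+ (d - M A).
Proof.
move=> q0 u0.
have -> : (q * t + 1 - q) / (1 - q) - 1 = q * t / (1 - q) by field.
have -> : q^-1 - 1 = (1 - q) / q by field.
have dA := rk_le_mrank A; have Ac := rk_card M A; have dm := mrank_le_card.
have Am : (#|A| <= m)%N := max_card _.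
move: (1 - q) u0 => u u0; rewrite /corank !exprMn !exprVn.
have -> : u ^+ d = u ^+ (d - M A) * u ^+ M A by rewrite -exprD subnK.
have -> : u ^+ #|A| = u ^+ (#|A| - M A) * u ^+ M A by rewrite -exprD subnK.
have qE : q ^+ (m - d) * q ^+ (d - M A) = q ^+ (m - #|A|) * q ^+ (#|A| - M A).
  by rewrite -!exprD !addnBA // subnK // subnK.
have ua : u ^+ (d - M A) != 0 by rewrite expf_neq0.
have qb : q ^+ (#|A| - M A) != 0 by rewrite expf_neq0.
move: qE ua qb; move: (q ^+ _) (q ^+ _) (q ^+ _) (q ^+ _) => q1 q2 q3 q4 qE ua qb.
move: (u ^+ (d - M A)) (u ^+ M A) (u ^+ (#|A| - M A)) (t ^+ _) ua => u1 u2 u3 t1 ua.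
apply: (mulIf qb); transitivity (u2 * u3 * t1 * (q4 * q3)).
  by field; rewrite ?ua ?qb.
by rewrite qE; ring.
Qed.

Lemma Y_subset_expansion (K : fieldType) (p t : K) : p != 0 -> 1 + p != 0 ->
  Y M (1 + p) t =
  \sum_(A : {set E}) (- p) ^+ #|A| * (1 + p) ^+ (m - #|A|) * t ^+ (d - M A).
Proof.
move=> p0 q0; have u0 : 1 - (1 + p) = - p by rewrite opprD addNKr.
have cE : corank M [set: E] = (m - d)%N by rewrite /corank cardsT.
rewrite /Y Tutte_atE mulr_sumr cE; apply: eq_bigr => A _.
by rewrite Y_term // u0 ?oppr_eq0.
Qed.

(** The weights [w A] sum to [(- p + (1 + p)) ^+ m = 1], so the subtracted power of [t] spreads over
    all [A], and each difference of powers of [- t] is a geometric sum times [1 + t]. *)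
Lemma Yhat_poly_numerator :
  (1 + 'X) * Yhat_poly =
  (-1) ^+ d * \sum_(A : {set E}) (- 'X%:P) ^+ #|A| * (1 + 'X%:P) ^+ (m - #|A|) * (- 'X) ^+ (d - M A)
    - 'X ^+ d.
Proof.
pose w A : {poly int} := (- 'X) ^+ #|A| * (1 + 'X) ^+ (m - #|A|).
have w1 : \sum_(A : {set E}) w A = 1 by rewrite sum_subsets_exprD addrC addrK expr1n.
have wP A : (- 'X%:P) ^+ #|A| * (1 + 'X%:P) ^+ (m - #|A|) = (w A)%:P :> polypt.
  by rewrite /w !(rmorphM, rmorphXn, rmorphN, rmorphD, rmorph1).
transitivity (\sum_(A : {set E}) (-1) ^+ d * (w A)%:P *
    \sum_(d - M A <= i < d) ((- 'X) ^+ i - (- 'X) ^+ i.+1) : polypt).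
  rewrite /Yhat_poly poly_def mulr_sumr.
  transitivity (\sum_(i < d) \sum_(A | in_S M i A)
      (-1) ^+ d * (w A)%:P * ((- 'X) ^+ i - (- 'X) ^+ i.+1) : polypt).
    apply: eq_bigr => i _; rewrite -mulr_suml -mulr_sumr -mul_polyC /Yhat_coef.
    rewrite rmorphM rmorph_sum /= rmorphXn rmorphN1 exprD exprS.
    by rewrite [(- 'X) ^+ i]exprNn; ring.
  (* The set [A] occurs in the coefficient [i] exactly when [d - M A <= i]. *)
  rewrite (exchange_big_dep xpredT) //=; apply: eq_bigr => A _; rewrite mulr_sumr.
  rewrite (big_nat_widenl _ 0) // big_mkord.
  by apply: eq_bigl => i; rewrite /in_S !leq_subLR addnC.
rewrite (eq_bigr (fun A => (-1) ^+ d * ((w A)%:P * (- 'X) ^+ (d - M A)) -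
    (-1) ^+ d * (- 'X) ^+ d * (w A)%:P)) => [|A _]; last first.
  rewrite (telescope_sumr_eq (fun i => - (- 'X) ^+ i)) ?leq_subr // => [|k _].
    by ring.
  by rewrite opprK addrC.
rewrite sumrB -!mulr_sumr -rmorph_sum w1 rmorph1 mulr1; congr (_ - _).
  by congr (_ * _); apply: eq_bigr => A _; rewrite wP.
by rewrite -exprMn mulN1r opprK.
Qed.

(** The quotients are legitimate because [p], [1 + p] and [1 + t] are nonzero in the fraction
    field. *)
Lemma Yhat_polyE : tofrac Yhat_poly = Yhat M.
Proof.
have X1 (R : nzRingType) : 1 + 'X != 0 :> {poly R}.
  by rewrite addrC -[1]polyC1 -size_poly_eq0 size_XaddC.
have t0 : 1 + tvar != 0 by rewrite /tvar -tofrac1 -tofracD tofrac_eq0 X1.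
have p0 : pvar != 0 by rewrite /pvar tofrac_eq0 polyC_eq0 polyX_eq0.
have q0 : 1 + pvar != 0.
  by rewrite /pvar -tofrac1 -tofracD tofrac_eq0 -[1]polyC1 -polyCD polyC_eq0 X1.
apply: (canRL (mulfK t0)); rewrite mulrC -tofrac1 -tofracD -tofracM.
rewrite Yhat_poly_numerator tofracB tofracM rmorph_sum /= !tofracXn tofracN tofrac1.
congr (_ * _ - _).
rewrite (Y_subset_expansion _ p0 q0); apply: eq_bigr => A _.
by rewrite !(tofracM, tofracXn, tofracN, tofracD, tofrac1).
Qed.

(** By [sum_supersets], the summand of [A] is [(-1) ^+ #|A|] times the sum of ['X ^+ #|T|] over the
    [T] containing [A]; collect by [T]. *)
Lemma coef_Yhat_coef i a : (i <= d)%N ->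
  (Yhat_coef i)`_a =
  \sum_(T : {set E} | #|T| == a) (-1) ^+ (d - i) * signed_sum (in_S M i) set0 T.
Proof.
move=> id; rewrite /Yhat_coef.
have -> : (-1) ^+ (i + d) = ((-1) ^+ (d - i))%:P :> {poly int}.
  by rewrite polyC_exp polyCN polyC1 -signr_odd -[RHS]signr_odd oddB // oddD addbC.
rewrite coefCM coef_sum -mulr_sumr; congr (_ * _).
transitivity (\sum_(A | in_S M i A) \sum_(T : {set E} | A \subset T)
    (-1) ^+ #|A| * (a == #|T|)%:R : int).
  apply: eq_bigr => A _; rewrite [(- 'X) ^+ _]exprNn -mulrA -sum_supersets mulr_sumr coef_sum.
  by apply: eq_bigr => T _; rewrite -polyC1 -polyCN -polyC_exp coefCM coefXn.
rewrite (exchange_big_dep xpredT) //= [RHS]big_mkcond; apply: eq_bigr => T _.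
rewrite -mulr_suml eq_sym; case: eqP => _; rewrite ?mulr0 // mulr1.
by apply: eq_bigl => A; rewrite sub0set andbC.
Qed.

End YhatPolynomial.

(** * Whitney homology of the truncation and the numbers [omega] *)

Section WhitneyHomology.
Variables (E : finType) (M : matroid E) (i : nat).
Local Notation r := (mrank M - i)%N.

(** Chains are the cliques of the comparability relation. *)
Lemma faces_order_complex (S : S_poset M i) (A : {set L_poset M i}) :
  (A \in faces (order_complex (\bot : L_poset M i)%O (Some S : L_poset M i))) =
  (A \subset between M i set0 (set_of_S S)) &&
    clique (fun x y : L_poset M i => (x >=< y)%O) A.
Proof.
have intv x : ((\bot : L_poset M i) < x < Some S)%O = (x \in between M i set0 (set_of_S S)).
  by case: x => [U|]; rewrite ?in_between ?sub0set ?L_poset_ltE // !inE.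
rewrite inE; congr (_ && _).
by apply/forall_inP/subsetP => h x /h; rewrite intv.
Qed.

(** For [T] in the truncation the integer is already nonnegative, by [order_complex_homology], so
    [absz] only changes its type. *)
Definition betti (T : {set E}) : nat :=
  absz ((-1) ^+ r * signed_sum (in_S M i) set0 T).

Lemma order_complex_homology (T : {set E}) :
  in_S M i T ->
  (betti T)%:Z = (-1) ^+ r * signed_sum (in_S M i) set0 T /\
  forall k, free_homology (fun x y : L_poset M i => (x >=< y)%O) (between M i set0 T) k
    (if k == #|T|%:Z - r%:Z - 1 then betti T else 0%N).
Proof.
have M0 : M set0 = 0%N by apply/eqP; rewrite -leqn0 -(cards0 E) rk_card.
move=> iT; have [|n nE nH] := between_homology (sub0set T) _ iT; rewrite ?M0 //.
rewrite cards0 M0 add0n in nE; rewrite /betti nE; split=> // k.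
by have := nH k; rewrite cards0 M0 subr0 addr0.
Qed.

(** The interval below [T] contributes in degree [#|T| - r - 1], and Whitney homology of degree [k]
    uses reduced homology of degree [k - 1]. *)
Lemma Whitney_homology_rank (k : int) :
  has_rank (Whitney_homology (L_poset M i) k)
    (\sum_(T | in_S M i T && (k == #|T|%:Z - r%:Z)%R) betti T)%N.
Proof.
pose b (x : L_poset M i) : nat :=
  if x is Some T then
    if k == #|set_of_S T|%:Z - r%:Z then betti (set_of_S T) else 0%N else 0%N.
have ex (s : {x : L_poset M i | (\bot < x)%O}) :
    exists h : 'I_(b (val s)) -> reduced_homology (order_complex \bot%O (val s)) (k - 1),
      Z_basis h.
  case: s => [[T|] //= T0]; apply: (homology_basis (faces_order_complex T)).
  have [_ /(_ (k - 1))] := order_complex_homology (S_posetP T).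
  by rewrite (inj_eq (addIr _)).
have := has_rank_direct_sum (fun s => projT2 (cid (ex s))).
congr has_rank; rewrite -(big_L_poset M i).
transitivity (\sum_(x : L_poset M i | (\bot < x)%O) b x)%N.
  rewrite [RHS](reindex_omap (val : {x : L_poset M i | (\bot < x)%O} -> _) insub).
    by apply: eq_bigl => x; rewrite valK eqxx (valP x).
  by move=> x x0; rewrite insubT.
by rewrite big_mkcond [RHS]big_mkcond; apply: eq_bigr => -[T|].
Qed.

Lemma omega_betti j : (i < mrank M)%N -> (1 <= j)%N ->
  omega M i j =
  (\sum_(T | in_S M i T && (j%:Z - 1 == #|T|%:Z - r%:Z)%R) betti T)%N%:Z.
Proof.
move=> id j1; rewrite /omega mulr_sumr (big_morph Posz PoszD (erefl 0%:Z)).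
apply: eq_big => [T|T /andP[iT /eqP cT]].
  congr (_ && _); apply/eqP/eqP; move: id; clear; lia.
rewrite (order_complex_homology iT).1 moebius_LE mulNr mulrN mulrA -exprD -mulNr.
(* Since [#|T| = r + j - 1], the exponent [j + #|T|] has parity opposite to [r], which absorbs the
   minus sign of [moebius_LE]. *)
congr (_ * _); have cj : (j + #|T| = r + j.-1.*2 + 1)%N by move: cT id j1; clear; lia.
by rewrite cj !exprD -mul2n exprM sqrrN !expr1n mulr1 mulrN1 opprK.
Qed.

End WhitneyHomology.
Theorem theorem3p1 (E : finType) (M : matroid E) (d m : nat)
    (hrank : mrank M = d) (hd : (1 <= d)%N) (hcard : #|E| = m)
    (hloop : forall e : E, ~~ loop M e) :
  exists2 Yhat_poly : polypt,
    tofrac Yhat_poly = Yhat M &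
    forall i j : nat, (i <= d - 1)%N -> (1 <= j <= m - d + 1 + i)%N ->
      coefpt (d - 1 - i + j) i Yhat_poly = omega M i j /\
      exists2 r : nat,
        has_rank (Whitney_homology (L_poset M i) (j%:Z - 1)) r &
        omega M i j = r%:Z.
Proof.
subst d m; exists (Yhat_poly M); first exact: Yhat_polyE.
move=> i j hi /andP[j1 _]; have id : (i < mrank M)%N by move: hi hd; clear; lia.
have omegaE := omega_betti id j1; split; last first.
  by eexists; [exact: Whitney_homology_rank | rewrite omegaE].
rewrite /coefpt /Yhat_poly coef_poly id coef_Yhat_coef 1?ltnW // omegaE.
rewrite (big_morph Posz PoszD (erefl 0%:Z)) [RHS]big_mkcondl.
have cardE (T : {set E}) :
    (#|T| == mrank M - 1 - i + j)%N = (j%:Z - 1 == #|T|%:Z - (mrank M - i)%N%:Z).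
  by apply/eqP/eqP; move: id j1; clear; lia.
apply: eq_big => T; first exact: cardE.
(* The coefficient ranges over all [T] of the right size; those outside the truncation contain no
   member of it, so their signed sum is empty. *)
move=> _; case: ifP => [iT|/negbT nT]; first by rewrite (order_complex_homology iT).1.
rewrite /signed_sum big_pred0 ?mulr0 // => A; apply/negbTE.
by apply: contra nT => /and3P[_]; exact: in_S_mono.
Qed.
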